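(* Let $S$ be an i.i.d. sample of size $n$ partitioned into $k\ge 2$ folds $S_1,\dots,S_k$ of equal size $m=n/k$, let $S_{-i}:=S\setminus S_i$, and let $S':=S\setminus(S_1\circ S_2)$ denote the shared training set of the first two cross-validated hypotheses. Assume that the empirical losses of the cross-validated hypotheses have the form $$\widehat L_i=\mu+\phi(S_i)\,\psi(S_{-i}),$$ where $\phi,\psi$ are real-valued functions and $\mu=\mathbb E[\widehat L_i]$. Then $$\mathrm{Cov}(\widehat L_1,\widehat L_2)=\mathbb E_{S'}\Big[\big(\mathbb E_{S_1}[\phi(S_1)\psi(S'\circ S_1)\mid S']\big)^2\Big].$$ Moreover, if $\phi(S_1)$ is centered, i.e. $\mathbb E[\phi(S_1)]=0$, then $$\mathrm{Cov}(\widehat L_1,\widehat L_2)=\mathbb E_{S'}\Big[\mathrm{Cov}\big(\phi(S_1),\psi(S'\circ S_1)\mid S'\big)^2\Big].$$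
   Context: Let $\mathcal Z=\mathcal X\times\mathcal Y$, let $\mathcal D$ be a distribution on $\mathcal Z$, and let $S=S^n=(Z_1,\dots,Z_n)\sim\mathcal D^n$ be i.i.d. A learning rule $\mathcal A$ maps finite samples to hypotheses $h:\mathcal X\to\mathcal Y$ and is permutation-invariant. The index set $\{1,\dots,n\}$ is partitioned into $k$ disjoint blocks $I_1,\dots,I_k$ of size $m=n/k$ (with $k\mid n$, $k\ge2$), $S_i=\{Z_j:j\in I_i\}$ and $S_{-i}=S\setminus S_i$. Given a loss $\ell:\mathcal Y\times\mathcal Y\to\mathbb R$, the loss on fold $i$ is $\widehat L_i=\frac1m\sum_{(x,y)\in S_i}\ell(\mathcal A(S_{-i})(x),y)$. $S_i\circ S_j$ denotes the concatenation of two samples; samples are treated as unordered collections, so $\phi$ and $\psi$ do not depend on the order of the sample points (e.g. $\psi(S_{-1})=\psi(S'\circ S_2)$ and $\psi(S_{-2})=\psi(S'\circ S_1)$). All expectations and covariances written are assumed to exist. *)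

(* Defs.v *)
From HB Require Import structures.
From mathcomp Require Import all_boot all_order all_algebra.
From mathcomp Require Import all_classical all_reals all_analysis.

Set Implicit Arguments.
Unset Strict Implicit.
Unset Printing Implicit Defensive.

Import Order.TTheory GRing.Theory Num.Theory.
Import numFieldNormedType.Exports.

Local Open Scope classical_set_scope.
Local Open Scope ring_scope.

Definition mutually_independent d (T : measurableType d) d'
    (T' : measurableType d') (R : realType) (P : probability T R)
    (I : finType) (Z : I -> {RV P >-> T'}) : Prop :=
  forall (J : {set I}) (A : I -> set T'),
    (forall j, j \in J -> measurable (A j)) ->
    P (\bigcap_(j in [set` J]) (Z j @^-1` A j)) =
    (\prod_(j in J) P (Z j @^-1` A j))%E.

Definition iid d (T : measurableType d) d' (T' : measurableType d')
    (R : realType) (P : probability T R) (D : probability T' R)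
    (I : finType) (Z : I -> {RV P >-> T'}) : Prop :=
  mutually_independent Z /\
  forall j A, measurable A -> distribution P (Z j) A = D A.

(* W is a version of E[X | sigma(V)]. *)
Definition is_condexp d (T : measurableType d) d' (T' : measurableType d')
    (R : realType) (P : probability T R) (V : T -> T') (X W : T -> R) : Prop :=
  [/\ forall B, measurable B ->
        preimage_set_system [set: T] V measurable (W @^-1` B),
      P.-integrable [set: T] (EFin \o W) &
      forall A, measurable A ->
        (\int[P]_(w in V @^-1` A) (W w)%:E =
         \int[P]_(w in V @^-1` A) (X w)%:E)%E].

(* An arbitrarily chosen version; 0 is only a default value for the case where
   no version exists (none is missing when V is measurable and X integrable). *)
Definition condexp d (T : measurableType d) d' (T' : measurableType d')
    (R : realType) (P : probability T R) (V : T -> T') (X : T -> R) : T -> R :=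
  xget (cst 0) [set W | is_condexp P V X W].

Definition condcov d (T : measurableType d) d' (T' : measurableType d')
    (R : realType) (P : probability T R) (V : T -> T') (X Y : T -> R) : T -> R :=
  condexp P V (fun w => (X w - condexp P V X w) * (Y w - condexp P V Y w)).

(* Samples are finite sequences; that they are unordered is expressed by
   requiring the functions of a sample to be invariant under permutations. *)
Definition perm_invariant (T : eqType) (U : Type) (f : seq T -> U) : Prop :=
  forall s t, perm_eq s t -> f s = f t.

Definition subsample (n : nat) (T U : Type) (Z : 'I_n -> T -> U)
    (J : {set 'I_n}) (w : T) : #|J|.-tuple U :=
  [tuple of [seq Z j w | j in J]].

Definition is_fold_partition (n k : nat) (I : 'I_k -> {set 'I_n}) : Prop :=
  [/\ forall i j, i != j -> (I i :&: I j)%SET = finset.set0,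
      (\bigcup_i I i)%SET = finset.setT &
      forall i, #|I i| = (n %/ k)%N].

Definition fold_loss (R : realType) (X Y : Type) (loss : Y -> Y -> R)
    (A : seq (X * Y) -> X -> Y) (train test : seq (X * Y)) : R :=
  (size test)%:R^-1 * \sum_(z <- test) loss (A train z.1) z.2.

Definition fold1 (k : nat) (hk : (2 <= k)%N) : 'I_k := Ordinal (ltnW hk).
Definition fold2 (k : nat) (hk : (2 <= k)%N) : 'I_k := Ordinal hk.

(* Main.v *)
Require Import Defs.
From HB Require Import structures.
From mathcomp Require Import all_boot all_order all_algebra.
From mathcomp Require Import all_classical all_reals all_analysis.
From mathcomp Require Import measurable_realfun zify ring.

Set Implicit Arguments.
Unset Strict Implicit.
Unset Printing Implicit Defensive.

Import Order.TTheory GRing.Theory Num.Theory.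
Import numFieldNormedType.Exports.

Local Open Scope classical_set_scope.
Local Open Scope ring_scope.

(** Write [g (s', s) = phi s * psi (s' ++ s)].  As samples are unordered, the
    first loss is measured on [S_1] with training sample [S' ++ S_2], and the
    second on [S_2] with training sample [S' ++ S_1].  Hence, almost surely,
    [(L_1 - mu) (L_2 - mu)
       = phi S_1 * psi (S' ++ S_2) * (phi S_2 * psi (S' ++ S_1))
       = g (S', S_1) * g (S', S_2)]:
    exchanging the two psi factors pairs each of them with the fold in its
    training sample.  Given [S'], the two factors are independent with the same law,
    so the conditional expectation of the product is the square of
    [E (g (S', S_1) | S')].

    Conditioning is made concrete through the joint law.  Independence and
    identical distribution of the points say that the triple [(S', (S_1, S_2))]
    has law [Q x (M x M)] ([law_disjoint_subsamples]; a measure on tuples is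
    determined by its values on cylinders, [cylinder_measure_unique]).  By
    Fubini, the partial integral [section_mean M g u], the integral of
    [g (u, v)] with respect to [M (dv)], then gives a version of the conditional
    expectation ([is_condexp_section_mean]), and
    [E (g (S', S_1) g (S', S_2))] is the integral of its square
    ([integral_section_mean_sqr]).  Since two versions of a conditional
    expectation agree almost surely ([is_condexp_ae_unique]), the chosen version
    [condexp] may be replaced by this one.

    When [phi S_1] is centered, [E (phi S_1 | S') = E (phi S_1) = 0] because
    [S_1] is independent of [S'], and
    [E (phi S_1 * E (psi (S' ++ S_1) | S') | S') = 0] for the same reason, so
    that the conditional covariance is the conditional expectation of the
    product ([condcov_centered]). *)

(** * Laws of disjoint subsamples *)

(** The cylinders form a pi-system, so it suffices that they generate the
    sigma-algebra of [E].  The first hypothesis says so in the form in which it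
    is available for products and tuples: a map into [E] is measurable as soon
    as its coordinates [f k] are.  Taking for that map the identity, from [E]
    with the sigma-algebra generated by the cylinders, gives the generation. *)
Lemma cylinder_measure_unique d (E : measurableType d) d'
    (T : measurableType d') (R : realType) (K : finType) (f : K -> E -> T)
    (m1 m2 : {measure set E -> \bar R}) :
  (forall d0 (E0 : measurableType d0) (h : E0 -> E),
     (forall k, measurable_fun [set: E0] (f k \o h)) ->
     measurable_fun [set: E0] h) ->
  (forall k, measurable_fun [set: E] (f k)) ->
  (m1 setT < +oo)%E ->
  (forall A : K -> set T, (forall k, measurable (A k)) ->
     m1 (\bigcap_k (f k @^-1` A k)) = m2 (\bigcap_k (f k @^-1` A k))) ->
  forall B, measurable B -> m1 B = m2 B.
Proof.
move=> genf mf m1oo m12.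
pose G : set (set E) := [set B | exists A : K -> set T,
  (forall k, measurable (A k)) /\ B = \bigcap_k (f k @^-1` A k)].
have GT : G setT.
  exists (fun _ => setT); split=> //.
  by apply/seteqP; split.
have GI : setI_closed G.
  move=> _ _ [A [mA ->]] [B [mB ->]].
  exists (fun k => A k `&` B k); split=> [k|]; first exact: measurableI.
  by rewrite -bigcapI.
have mG : G `<=` measurable.
  move=> _ [A [mA ->]]; apply: fin_bigcap_measurable => //= k _.
  by rewrite -[X in measurable X]setTI; exact: mf.
have sG : measurable = <<s G >>.
  apply/seteqP; split; last first.
    by apply: smallest_sub; [exact: sigma_algebra_measurable|].
  have mid : measurable_fun [set: g_sigma_algebraType G]
      (idfun : g_sigma_algebraType G -> E).
    apply: genf => k _ B mB; rewrite setTI; apply: sub_sigma_algebra.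
    exists (fun j => if j == k then B else setT); split=> [j|].
      by case: ifP.
    apply/seteqP; split=> [x fx j _ /=|x /(_ k I)/=].
      by case: eqP => // ->.
    by rewrite eqxx.
  by move=> B mB; move: (mid measurableT B mB); rewrite setTI.
apply: (measure_unique G (fun=> setT)) => //.
- by apply/seteqP; split=> // x _; exists 0%N.
- by move=> _ [A [mA ->]]; exact: m12.
Qed.

(** Mutual independence ranges over subsets of indices; an injective family of
    indices is handled by transporting the events to its image. *)
Lemma iid_cylinder d (T : measurableType d) d' (T' : measurableType d')
    (R : realType) (P : probability T R) (D : probability T' R)
    (I K : finType) (Z : I -> {RV P >-> T'}) (e : K -> I) (A : K -> set T') :
  iid D Z -> injective e -> (forall k, measurable (A k)) ->
  P (\bigcap_k ((Z (e k) : T -> T') @^-1` A k)) = (\prod_k D (A k))%E.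
Proof.
move=> [indZ lawZ] e_inj mA.
(* Outside the image of [e] the event is everything, which leaves both sides
   unchanged. *)
pose A' i := if [pick k | e k == i] is Some k then A k else setT.
have A'e k : A' (e k) = A k.
  rewrite /A'; case: pickP => [j /eqP /e_inj -> //|/(_ k)].
  by rewrite eqxx.
have mA' i : measurable (A' i) by rewrite /A'; case: pickP.
transitivity (P (\bigcap_(i in [set` [set e k | k : K]%SET])
    ((Z i : T -> T') @^-1` A' i))).
  congr (P _); apply/seteqP; split=> x /= xA.
    by move=> _ /= /imsetP[k _ ->]; rewrite A'e; exact: xA.
  by move=> k _; have /= := xA (e k) (imset_f _ (erefl _)); rewrite A'e; exact.
rewrite indZ// big_imset/=; last by move=> j k _ _; exact: e_inj.
by apply: eq_bigr => k _; rewrite A'e; exact: lawZ.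
Qed.

(** The product measure with its structure of probability fixed, so that
    products can be nested. *)
Definition prod_prob d1 d2 (T1 : measurableType d1) (T2 : measurableType d2)
    (R : realType) (m1 : probability T1 R) (m2 : probability T2 R) :
  probability (T1 * T2)%type R := (m1 \x m2)%E.

Lemma prod_probX d1 d2 (T1 : measurableType d1) (T2 : measurableType d2)
    (R : realType) (m1 : probability T1 R) (m2 : probability T2 R) A B :
  measurable A -> measurable B -> prod_prob m1 m2 (A `*` B) = (m1 A * m2 B)%E.
Proof. exact: product_measure1E. Qed.

Definition has_law d d' (T : measurableType d) (E : measurableType d')
    (R : realType) (P : probability T R) (X : T -> E) (m : probability E R) :=
  forall C, measurable C -> P (X @^-1` C) = m C.

(** [U], [V] and [V'] list the sample at pairwise disjoint index families, and
    both sides agree on cylinders, where independence makes them the same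
    product over all the indices. The law of [V] occurs twice because [V] and
    [V'] have the same size and the points are identically distributed. *)
Lemma law_disjoint_subsamples d (T : measurableType d) d'
    (T' : measurableType d') (R : realType) (P : probability T R)
    (D : probability T' R) (J : finType) (Z : J -> {RV P >-> T'}) (a b : nat)
    (U : {RV P >-> a.-tuple T'}) (V V' : {RV P >-> b.-tuple T'})
    (e : 'I_a + ('I_b + 'I_b) -> J) :
  iid D Z -> injective e ->
  (forall i w, tnth (U w) i = Z (e (inl i)) w) ->
  (forall i w, tnth (V w) i = Z (e (inr (inl i))) w) ->
  (forall i w, tnth (V' w) i = Z (e (inr (inr i))) w) ->
  has_law P (fun w => (U w, (V w, V' w)))
    (prod_prob (distribution P U)
      (prod_prob (distribution P V) (distribution P V))).
Proof.
move=> hZ e_inj UE VE V'E.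
pose f (k : 'I_a + ('I_b + 'I_b))
    (x : a.-tuple T' * (b.-tuple T' * b.-tuple T')) :=
  match k with
  | inl i => tnth x.1 i
  | inr (inl i) => tnth x.2.1 i
  | inr (inr i) => tnth x.2.2 i
  end.
have mUVV : measurable_fun [set: T] (fun w => (U w, (V w, V' w))).
  by do 2?apply: measurable_fun_pair.
pose UVV : {mfun T >-> (a.-tuple T' * (b.-tuple T' * b.-tuple T'))%type} :=
  HB.pack (fun w => (U w, (V w, V' w))) (isMeasurableFun.Build _ _ _ _ _ mUVV).
move=> C mC.
apply: (@cylinder_measure_unique _ _ _ _ _ _ f (distribution P UVV)
  (prod_prob (distribution P U)
    (prod_prob (distribution P V) (distribution P V)))) => //.
- move=> d0 E0 h mh; apply/measurable_fun_pairP; split; last first.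
    apply/measurable_fun_pairP; split.
    + by apply/measurable_fun_tnthP => i; exact: (mh (inr (inl i))).
    + by apply/measurable_fun_tnthP => i; exact: (mh (inr (inr i))).
  by apply/measurable_fun_tnthP => i; exact: (mh (inl i)).
- case=> [i|[i|i]].
  + by apply: (measurableT_comp (measurable_tnth i)).
  + apply: (measurableT_comp (measurable_tnth i)).
    exact: (measurableT_comp measurable_fst measurable_snd).
  + apply: (measurableT_comp (measurable_tnth i)).
    exact: (measurableT_comp measurable_snd measurable_snd).
- by rewrite (le_lt_trans (probability_le1 _ _)) ?ltry.
move=> A mA.
pose AU := \bigcap_i ((fun u : a.-tuple T' => tnth u i) @^-1` A (inl i)).
pose AV (B : 'I_b -> set T') :=
  \bigcap_i ((fun u : b.-tuple T' => tnth u i) @^-1` B i).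
have mcyl n (B : 'I_n -> set T') : (forall i, measurable (B i)) ->
    measurable (\bigcap_i ((fun u : n.-tuple T' => tnth u i) @^-1` B i)).
  move=> mB; apply: fin_bigcap_measurable => //= i _.
  by rewrite -[X in measurable X]setTI; exact: measurable_tnth.
have -> : \bigcap_k (f k @^-1` A k) =
    AU `*` (AV (fun i => A (inr (inl i))) `*` AV (fun i => A (inr (inr i)))).
  apply/seteqP; split=> [x xA|x [xU [xV xV']] [i|[i|i]] _].
  - split; first by move=> i _; exact: (xA (inl i)).
    split.
    + by move=> i _; exact: (xA (inr (inl i))).
    + by move=> i _; exact: (xA (inr (inr i))).
  - exact: xU.
  - exact: xV.
  - exact: xV'.
have lawV B : (forall i, measurable (B i)) ->
    distribution P V (AV B) = (\prod_i D (B i))%E.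
  move=> mB; rewrite -(iid_cylinder (e := e \o inr \o inl) hZ)//; last first.
    by move=> i j /e_inj[].
  congr (P _); apply/seteqP; split=> x xB i _ /=; have /= := xB i I.
    by rewrite VE.
  by rewrite VE.
rewrite [RHS]prod_probX; [|exact: mcyl|by apply: measurableX; exact: mcyl].
rewrite [X in (_ * X)%E]prod_probX; [|exact: mcyl|exact: mcyl].
rewrite [X in (_ * (X * _))%E]lawV// [X in (_ * (_ * X))%E]lawV//.
have lawU : distribution P U AU = (\prod_i D (A (inl i)))%E.
  rewrite -(iid_cylinder (e := e \o inl) hZ)//; last first.
    by move=> i j /e_inj[].
  congr (P _); apply/seteqP; split=> x xB i _ /=; have /= := xB i I.
    by rewrite UE.
  by rewrite UE.
rewrite [X in (X * _)%E]lawU.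
transitivity (P (\bigcap_k ((Z (e k) : T -> T') @^-1` A k))).
  congr (P _); apply/seteqP; split=> x /=.
    move=> [xU [xV xV']] [i|[i|i]] _ /=.
    - by have /= := xU i I; rewrite UE.
    - by have /= := xV i I; rewrite VE.
    - by have /= := xV' i I; rewrite V'E.
  move=> xA; split; first by move=> i _ /=; rewrite UE; exact: (xA (inl i)).
  split=> i _ /=; first by rewrite VE; exact: (xA (inr (inl i))).
  by rewrite V'E; exact: (xA (inr (inr i))).
rewrite (iid_cylinder hZ)//.
by rewrite big_sumType/= big_sumType.
Qed.

(** * Conditional expectations are almost surely unique *)

(** Both versions are measurable for the sigma-algebra generated by [V] and have
    the same integral on each of its sets.  On the space [T0] carrying this
    sigma-algebra only, with the image of [P] under the identity, this is the
    hypothesis under which two functions agree almost everywhere, and a null set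
    of [T0] is a null set of [T]. *)
Lemma is_condexp_ae_unique d (T : measurableType d) d' (T' : measurableType d')
    (R : realType) (P : probability T R) (V : T -> T') (X W1 W2 : T -> R) :
  measurable_fun setT V ->
  is_condexp P V X W1 -> is_condexp P V X W2 -> ae_eq P setT W1 W2.
Proof.
move=> mV [sW1 iW1 eW1] [sW2 iW2 eW2].
pose T0 : measurableType (preimage_display V) := g_sigma_algebra_preimageType V.
have mid : measurable_fun [set: T] (idfun : T -> T0).
  by move=> _ _ [B mB <-]; rewrite setTI setTI -[X in measurable X]setTI; exact: mV.
have mW (W : T -> R) : (forall B, measurable B ->
    preimage_set_system [set: T] V measurable (W @^-1` B)) ->
    measurable_fun [set: T0] (fun w : T0 => (W w)%:E).
  move=> sW; apply/measurable_EFinP => _ B mB; rewrite setTI; exact: sW.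
pose id0 : {mfun T >-> T0} := HB.pack (idfun : T -> T0)
  (isMeasurableFun.Build _ _ _ _ _ mid).
pose P0 := distribution P id0.
have iW1' : P0.-integrable setT (fun w : T0 => (W1 w)%:E).
  by apply: integrable_pushforward => //; [exact: mW].
have iW2' : P0.-integrable setT (fun w : T0 => (W2 w)%:E).
  by apply: integrable_pushforward => //; [exact: mW].
have : ae_eq P0 setT (fun w : T0 => (W1 w)%:E) (fun w : T0 => (W2 w)%:E).
  apply: integral_ae_eq => //; first exact: mW.
  move=> E _ mE; case: (mE) => B mB; rewrite setTI => BE.
  rewrite !integral_pushforward//; [|exact: mW| |exact: mW|].
  - by rewrite -BE; rewrite [LHS]eW1// [RHS]eW2.
  - apply: (integrableS measurableT) => //; rewrite -BE -[X in measurable X]setTI.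
    exact: mV.
  - apply: (integrableS measurableT) => //; rewrite -BE -[X in measurable X]setTI.
    exact: mV.
move=> [N [mN PN sub]]; exists N; split=> //.
- by move: (mid measurableT N mN); rewrite setTI.
- by apply: subset_trans sub => w /= nw h; apply: nw => _; have [] := h I.
Qed.

Lemma condexpP d (T : measurableType d) d' (T' : measurableType d')
    (R : realType) (P : probability T R) (V : T -> T') (X W : T -> R) :
  is_condexp P V X W -> is_condexp P V X (condexp P V X).
Proof. by move=> XW; rewrite /condexp; case: xgetP => [_ _ //|/(_ W)]. Qed.

Lemma condexp_ae_eq d (T : measurableType d) d' (T' : measurableType d')
    (R : realType) (P : probability T R) (V : T -> T') (X W : T -> R) :
  measurable_fun setT V -> is_condexp P V X W -> ae_eq P setT (condexp P V X) W.
Proof.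
by move=> mV XW; apply: is_condexp_ae_unique (condexpP XW) XW.
Qed.

(** Whether or not a version exists: the default value is constant. *)
Lemma measurable_condexp d (T : measurableType d) d' (T' : measurableType d')
    (R : realType) (P : probability T R) (V : T -> T') (X : T -> R) :
  measurable_fun setT V -> measurable_fun setT (condexp P V X).
Proof.
move=> mV; rewrite /condexp; case: xgetP => [W _ [sW _ _]|_]; last first.
  exact: measurable_cst.
move=> _ B mB; rewrite setTI; have [C mC <-] := sW _ mB; exact: mV.
Qed.

Lemma is_condexp_ae_eqr d (T : measurableType d) d' (T' : measurableType d')
    (R : realType) (P : probability T R) (V : T -> T') (X X' W : T -> R) :
  measurable_fun setT V -> measurable_fun setT X -> measurable_fun setT X' ->
  ae_eq P setT X X' -> is_condexp P V X W -> is_condexp P V X' W.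
Proof.
move=> mV mX mX' XX' [sW iW eW]; split=> // A mA; rewrite eW//.
have mVA : measurable (V @^-1` A) by rewrite -[V @^-1` A]setTI; exact: mV.
apply: ae_eq_integral => //.
- by apply/measurable_EFinP; exact: measurable_funTS.
- by apply/measurable_EFinP; exact: measurable_funTS.
- by apply: filterS XX' => w /= /(_ I) ->.
Qed.

(** * Integration with respect to product laws *)

(** Fubini's theorem for [prod_prob], whose factors may themselves be products. *)
Section product_of_probabilities.
Context d1 d2 (T1 : measurableType d1) (T2 : measurableType d2) (R : realType).
Variables (m1 : probability T1 R) (m2 : probability T2 R).

Lemma integral_prod_prob f : (prod_prob m1 m2).-integrable setT f ->
  (\int[m1]_x \int[m2]_y f (x, y) = \int[prod_prob m1 m2]_z f z)%E.
Proof. exact: (@integral12_prod_meas1 _ _ _ _ _ m1 m2). Qed.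

Lemma integrable_prod_probP f : measurable_fun setT f ->
  (prod_prob m1 m2).-integrable setT f <->
  (\int[m1]_x \int[m2]_y `|f (x, y)| < +oo)%E.
Proof. exact: (@integrable12ltyP _ _ _ _ _ m1 m2). Qed.

Lemma ae_integrable_prod_prob f : (prod_prob m1 m2).-integrable setT f ->
  {ae m1, forall x, m2.-integrable setT (fun y => f (x, y))}.
Proof. exact: (@ae_integrable1 _ _ _ _ _ m1 m2). Qed.

Lemma measurable_integral_prod_prob f : (prod_prob m1 m2).-integrable setT f ->
  measurable_fun setT (fun x => \int[m2]_y f (x, y))%E.
Proof. exact: (@measurable_fubini_F _ _ _ _ _ m1 m2). Qed.

Lemma integrable_integral_prod_prob f : (prod_prob m1 m2).-integrable setT f ->
  m1.-integrable setT (fun x => \int[m2]_y f (x, y))%E.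
Proof. exact: (@integrable_fubini_F _ _ _ _ _ m1 m2). Qed.

Lemma integrable_tensor (f1 : T1 -> R) (f2 : T2 -> R) :
  m1.-integrable setT (EFin \o f1) -> m2.-integrable setT (EFin \o f2) ->
  (prod_prob m1 m2).-integrable setT (fun z => (f1 z.1 * f2 z.2)%:E).
Proof.
move=> if1 if2.
have mf1 : measurable_fun setT f1 by apply/measurable_EFinP; exact: measurable_int if1.
have mf2 : measurable_fun setT f2 by apply/measurable_EFinP; exact: measurable_int if2.
apply/integrable_prod_probP.
  apply/measurable_EFinP; apply: measurable_funM.
    exact: (measurableT_comp mf1 measurable_fst).
  exact: (measurableT_comp mf2 measurable_snd).
under eq_integral => x _.
  under eq_integral => y _ do rewrite /= normrM EFinM.
  rewrite ge0_integralZl//; last by do 2 apply: measurableT_comp.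
  over.
case/integrableP: if2 => _ if2; case/integrableP: if1 => _ if1.
rewrite ge0_integralZr//; first last.
- exact: integral_ge0.
- by do 2 apply: measurableT_comp.
by rewrite lte_mul_pinfty ?integral_ge0// ge0_fin_numE ?integral_ge0.
Qed.

End product_of_probabilities.

(** Change of variables along a map whose law is known on measurable sets only
    as the values of another probability. *)
Section transfer_along_law.
Context d d' (T : measurableType d) (E : measurableType d') (R : realType).
Variables (P : probability T R) (X : T -> E) (m : probability E R).
Hypotheses (mX : measurable_fun setT X) (lawX : has_law P X m).

Let rvX : {RV P >-> E} := HB.pack X (isMeasurableFun.Build _ _ _ _ _ mX).

Let integral_distributionE A f :
  (\int[distribution P rvX]_(x in A) f x = \int[m]_(x in A) f x)%E.
Proof. by apply: eq_measure_integral => B mB _; exact: lawX. Qed.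

Lemma integrable_law (f : E -> R) : measurable_fun setT f ->
  m.-integrable setT (EFin \o f) <-> P.-integrable setT (EFin \o (f \o X)).
Proof.
move=> mf.
have mf' : measurable_fun setT (EFin \o f) by exact/measurable_EFinP.
have mfX : measurable_fun setT (EFin \o (f \o X)).
  by apply/measurable_EFinP; exact: measurableT_comp.
have normE : (\int[m]_x `|(f x)%:E| = \int[P]_w `|(f (X w))%:E|)%E.
  rewrite -integral_distributionE ge0_integral_distribution//.
  exact: measurableT_comp.
by split=> /integrableP[_ fi]; apply/integrableP; split=> //;
  [rewrite -normE|rewrite normE].
Qed.

Lemma integral_law (f : E -> R) A : measurable_fun setT f ->
  P.-integrable setT (EFin \o (f \o X)) -> measurable A ->
  (\int[m]_(x in A) (f x)%:E = \int[P]_(w in X @^-1` A) (f (X w))%:E)%E.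
Proof.
move=> mf fi mA.
rewrite -integral_distributionE integral_pushforward//.
  exact/measurable_EFinP.
apply: integrableS fi => //.
by rewrite -[X in measurable X]setTI; exact: mX.
Qed.

End transfer_along_law.

Lemma has_law_pair d (T : measurableType d) d1 d2
    (E1 : measurableType d1) (E2 : measurableType d2) (R : realType)
    (P : probability T R) (U : {RV P >-> E1}) (V V' : {RV P >-> E2}) :
  has_law P (fun w => (U w, (V w, V' w)))
    (prod_prob (distribution P U)
      (prod_prob (distribution P V) (distribution P V))) ->
  has_law P (fun w => (U w, V w))
    (prod_prob (distribution P U) (distribution P V)).
Proof.
move=> lawUVV C mC.
have mUV : measurable_fun setT (fun w => (U w, V w)).
  exact: measurable_fun_pair.
pose UV : {RV P >-> (E1 * E2)%type} :=
  HB.pack (fun w => (U w, V w)) (isMeasurableFun.Build _ _ _ _ _ mUV).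
apply/esym.
apply: (@product_measure_unique _ _ _ _ _ _ _ (distribution P UV)) => //.
move=> A B mA mB.
have mBT : measurable (B `*` [set: E2]) by exact: measurableX.
have := lawUVV (A `*` (B `*` setT)) (measurableX mA mBT).
rewrite [RHS]prod_probX// [X in (_ * X)%E]prod_probX//.
rewrite [X in (_ * (_ * X))%E]probability_setT mule1 => <-.
by congr (P _); apply/seteqP; split=> [w [? ?]|w [? []]].
Qed.

Lemma ae_distribution d d' (T : measurableType d) (E : measurableType d')
    (R : realType) (P : probability T R) (X : {RV P >-> E}) (p : E -> Prop) :
  {ae distribution P X, forall x, p x} -> {ae P, forall w, p (X w)}.
Proof.
move=> [N [mN PN sub]]; exists (X @^-1` N); split=> //.
  by rewrite -[X in measurable X]setTI; exact: measurable_funP.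
by move=> w; exact: sub.
Qed.

Lemma integrable_ae_eq d (T : measurableType d) (R : realType)
    (mu : {measure set T -> \bar R}) (f g : T -> \bar R) :
  measurable_fun setT g -> ae_eq mu setT f g ->
  mu.-integrable setT f -> mu.-integrable setT g.
Proof.
move=> mg fg /integrableP[mf fi]; apply/integrableP; split=> //.
rewrite (ae_eq_integral (fun x => `|f x|)%E) //; try exact: measurableT_comp.
by apply: filterS fg => x /= /[apply] ->.
Qed.

(** * Conditioning on one component of a product law *)

Lemma RintegralE d (T : measurableType d) (R : realType)
    (m : probability T R) (f : T -> R) :
  m.-integrable setT (EFin \o f) ->
  (\int[m]_x f x)%:E = (\int[m]_x (f x)%:E)%E.
Proof. by move=> fi; rewrite fineK//; exact: integrable_fin_num fi. Qed.

Section section_mean.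
Context d1 d2 (E1 : measurableType d1) (E2 : measurableType d2) (R : realType).
Variables (Q : probability E1 R) (M : probability E2 R) (g : E1 * E2 -> R).
Hypothesis ig : (prod_prob Q M).-integrable setT (EFin \o g).

(** The conditional expectation of [g (U, V)] at [U = u] when [U] and [V] are
    independent and [V] has law [M]. *)
Definition section_mean (u : E1) : R := \int[M]_v g (u, v).

Lemma measurable_section_mean : measurable_fun setT section_mean.
Proof.
apply: measurableT_comp; first exact: fine_measurable.
exact: (measurable_integral_prod_prob ig).
Qed.

Lemma section_meanE :
  {ae Q, forall u, (section_mean u)%:E = (\int[M]_v (g (u, v))%:E)%E}.
Proof. by apply: filterS (ae_integrable_prod_prob ig) => u; exact: RintegralE. Qed.

Lemma integrable_section_mean : Q.-integrable setT (EFin \o section_mean).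
Proof.
apply: le_integrable (integrable_integral_prod_prob ig) => //.
  by apply/measurable_EFinP; exact: measurable_section_mean.
by move=> u _; rewrite /= /section_mean /Rintegral; case: integral => *; rewrite ?leey.
Qed.

(** Restricting [g] to the strip [A `*` setT] restricts the mean to [A]. *)
Lemma integral_section_mean A : measurable A ->
  (\int[Q]_(u in A) (section_mean u)%:E =
   \int[prod_prob Q M]_(z in A `*` setT) (g z)%:E)%E.
Proof.
move=> mA.
have mAT : measurable (A `*` [set: E2]) by exact: measurableX.
have igA : (prod_prob Q M).-integrable setT ((EFin \o g) \_ (A `*` setT)).
  by apply/(integrable_mkcond _ mAT).1; exact: integrableS ig.
rewrite [RHS]integral_mkcond -(integral_prod_prob igA) [LHS]integral_mkcond.
apply: ae_eq_integral => //.
- apply/(measurable_restrict _ _ _).1 => //; apply/measurable_EFinP.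
  by apply: measurable_funTS; exact: measurable_section_mean.
- exact: measurable_integral_prod_prob igA.
apply: filterS section_meanE => u uE _; rewrite !patchE.
case: ifPn => uA.
  rewrite uE; apply: eq_integral => v _; rewrite patchE ifT//.
  by rewrite in_setX uA in_setT.
rewrite integral0_eq// => v _; rewrite patchE ifF//.
by apply/negbTE; rewrite in_setX (negbTE uA).
Qed.

End section_mean.

Lemma integral_prod_prob_mul d1 d2 (E1 : measurableType d1) (E2 : measurableType d2)
    (R : realType) (m1 : probability E1 R) (m2 : probability E2 R)
    (f1 : E1 -> R) (f2 : E2 -> R) :
  m1.-integrable setT (EFin \o f1) -> m2.-integrable setT (EFin \o f2) ->
  (\int[prod_prob m1 m2]_z (f1 z.1 * f2 z.2)%:E =
   ((\int[m1]_x f1 x) * (\int[m2]_y f2 y))%R%:E)%E.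
Proof.
move=> if1 if2; rewrite -integral_prod_prob; last exact: integrable_tensor.
under eq_integral => x _.
  under eq_integral => y _ do rewrite /= EFinM.
  rewrite integralZl// -RintegralE//.
  over.
by rewrite integralZr// -RintegralE// EFinM.
Qed.

(** The event [U \in A] is the preimage under [(U, V)] of the strip
    [A `*` setT], on which Fubini's theorem integrates [g] in [v] first. *)
Lemma is_condexp_section_mean d (T : measurableType d) d1 d2
    (E1 : measurableType d1) (E2 : measurableType d2) (R : realType)
    (P : probability T R) (U : {RV P >-> E1}) (V : {RV P >-> E2})
    (g : E1 * E2 -> R) :
  has_law P (fun w => (U w, V w))
    (prod_prob (distribution P U) (distribution P V)) ->
  measurable_fun setT g ->
  P.-integrable setT (fun w => (g (U w, V w))%:E) ->
  is_condexp P U (fun w => g (U w, V w)) (section_mean (distribution P V) g \o U).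
Proof.
move=> lawUV mg ig.
have mU : measurable_fun setT U by exact: measurable_funP.
have mUV : measurable_fun setT (fun w => (U w, V w)).
  exact: measurable_fun_pair.
have lawU : has_law P U (distribution P U) by [].
have ig' := (integrable_law mUV lawUV mg).2 ig.
have mh := measurable_section_mean ig'.
have ih := (integrable_law mU lawU mh).1 (integrable_section_mean ig').
split=> [B mB||A mA]; last 1 first.
- rewrite -(integral_law mU lawU mh ih)// integral_section_mean//.
  rewrite (integral_law mUV lawUV mg)//; last exact: measurableX.
  by congr integral; apply/seteqP; split=> [w []|].
- exists (section_mean (distribution P V) g @^-1` B); rewrite ?setTI//.
  by rewrite -[X in measurable X]setTI; exact: mh.
- exact: ih.
Qed.

(** For fixed [u], the integral of [g (u, v) * g (u, v')] over [M x M] is the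
    product of two equal integrals. *)
Lemma integral_section_mean_sqr d (T : measurableType d) d1 d2
    (E1 : measurableType d1) (E2 : measurableType d2) (R : realType)
    (P : probability T R) (U : {RV P >-> E1}) (V V' : {RV P >-> E2})
    (g : E1 * E2 -> R) :
  has_law P (fun w => (U w, (V w, V' w)))
    (prod_prob (distribution P U)
      (prod_prob (distribution P V) (distribution P V))) ->
  measurable_fun setT g ->
  P.-integrable setT (fun w => (g (U w, V w))%:E) ->
  P.-integrable setT (fun w => (g (U w, V w) * g (U w, V' w))%:E) ->
  (\int[P]_w (g (U w, V w) * g (U w, V' w))%:E =
   \int[P]_w (section_mean (distribution P V) g (U w) ^+ 2)%:E)%E.
Proof.
move=> lawUVV mg igUV igg.
have mUV : measurable_fun setT (fun w => (U w, V w)).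
  exact: measurable_fun_pair.
have mUVV : measurable_fun setT (fun w => (U w, (V w, V' w))).
  by do 2?apply: measurable_fun_pair.
have ig := (integrable_law mUV (has_law_pair lawUVV) mg).2 igUV.
pose gg (z : E1 * (E2 * E2)) := g (z.1, z.2.1) * g (z.1, z.2.2).
have mgg : measurable_fun setT gg.
  apply: measurable_funM; apply: (measurableT_comp mg).
    apply: measurable_fun_pair => //.
    exact: (measurableT_comp measurable_fst measurable_snd).
  apply: measurable_fun_pair => //.
  exact: (measurableT_comp measurable_snd measurable_snd).
have igg' := (integrable_law mUVV lawUVV mgg).2 igg.
have mh2 : measurable_fun setT
    (fun u => (section_mean (distribution P V) g u ^+ 2)%:E).
  apply/measurable_EFinP; apply: measurable_funX.
  exact: measurable_section_mean ig.
transitivity (\int[distribution P U]_u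
    (section_mean (distribution P V) g u ^+ 2)%:E)%E; last first.
  by rewrite ge0_integral_distribution// => u; rewrite lee_fin sqr_ge0.
have := integral_law mUVV lawUVV mgg igg measurableT.
rewrite preimage_setT => <-.
rewrite -integral_prod_prob//; apply: ae_eq_integral => //.
  exact: (measurable_integral_prod_prob igg').
apply: filterS (ae_integrable_prod_prob ig) => u iu _.
by rewrite [LHS](integral_prod_prob_mul (f1 := fun v => g (u, v)) iu iu) expr2.
Qed.

(** With [q] the conditional mean of [p (U, V)] given [U], the conditional
    covariance is almost surely the conditional mean of
    [f V * (p (U, V) - q U)], because the conditional mean of [f V] is its mean
    [0].  The correction [f V * q U] integrates to [q u * 0] over each section,
    so the section means of this function and of [f V * p (U, V)] agree for
    almost every [u]. *)
Lemma condcov_centered d (T : measurableType d) d1 d2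
    (E1 : measurableType d1) (E2 : measurableType d2) (R : realType)
    (P : probability T R) (U : {RV P >-> E1}) (V : {RV P >-> E2})
    (f : E2 -> R) (p : E1 * E2 -> R) :
  has_law P (fun w => (U w, V w))
    (prod_prob (distribution P U) (distribution P V)) ->
  measurable_fun setT f -> measurable_fun setT p ->
  P.-integrable setT (fun w => (f (V w))%:E) ->
  P.-integrable setT (fun w => (p (U w, V w))%:E) ->
  P.-integrable setT (fun w => (f (V w) * p (U w, V w))%:E) ->
  (\int[P]_w (f (V w))%:E = 0)%E ->
  ae_eq P setT (condcov P U (f \o V) (fun w => p (U w, V w)))
               (condexp P U (fun w => f (V w) * p (U w, V w))).
Proof.
move=> lawUV mf mp iF ip ifp Ef0.
have mU : measurable_fun setT U by exact: measurable_funP.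
have mV : measurable_fun setT V by exact: measurable_funP.
have mUV : measurable_fun setT (fun w => (U w, V w)).
  exact: measurable_fun_pair.
pose Q := distribution P U; pose M := distribution P V.
have lawV : has_law P V M by [].
have transfer g := (integrable_law (f := g) mUV lawUV).
have iM := (integrable_law mV lawV mf).2 iF.
have Mf0 : (\int[M]_v f v = 0)%R.
  by rewrite /Rintegral (integral_law mV lawV)// preimage_setT [X in fine X]Ef0.
pose q := section_mean M p.
have ip' := (transfer _ mp).2 ip.
have mq : measurable_fun setT q by exact: measurable_section_mean ip'.
have iq : Q.-integrable setT (EFin \o q) by exact: integrable_section_mean ip'.
have mfsnd : measurable_fun setT (fun z : E1 * E2 => f z.2).
  exact: (measurableT_comp mf measurable_snd).
have Ef : ae_eq P setT (condexp P U (f \o V)) (cst 0).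
  have := condexp_ae_eq mU (is_condexp_section_mean lawUV mfsnd iF).
  by apply: filterS => w + _ => /(_ I) ->; rewrite /= /section_mean/= Mf0.
have Ep := condexp_ae_eq mU (is_condexp_section_mean lawUV mp ip).
(* [g2] is the integrand of the conditional covariance, up to a null set. *)
pose g z := f z.2 * p z; pose g2 z := f z.2 * (p z - q z.1).
have mg : measurable_fun setT g by exact: measurable_funM.
have mg2 : measurable_fun setT g2.
  apply: measurable_funM => //; apply: measurable_funB => //.
  exact: (measurableT_comp mq measurable_fst).
have iqf : P.-integrable setT (fun w => (q (U w) * f (V w))%:E).
  apply: (transfer (fun z => q z.1 * f z.2) _).1.
    apply: measurable_funM => //; exact: (measurableT_comp mq measurable_fst).
  exact: (integrable_tensor iq iM).
have ig2 : P.-integrable setT (fun w => (g2 (U w, V w))%:E).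
  have := integrableB measurableT ifp iqf; apply: eq_integrable => // w _.
  by rewrite /= -EFinB /g2/= mulrBr (mulrC (q _)).
have ig2' := (transfer _ mg2).2 ig2.
have ig' := (transfer _ mg).2 ifp.
have cE := is_condexp_section_mean lawUV mg2 ig2.
have g2E : {ae P, forall w, section_mean M g2 (U w) = section_mean M g (U w)}.
  apply: (ae_distribution (X := U)
    (p := fun u => section_mean M g2 u = section_mean M g u)).
  apply: filterS (ae_integrable_prod_prob ig') => u iu.
  rewrite /section_mean.
  under eq_Rintegral do rewrite /g2 mulrBr.
  rewrite RintegralB//; last exact: (integrableZr measurableT (q u) iM).
  rewrite [X in _ - X](_ : _ = (\int[M]_v (f v * q u))%R)//.
  by rewrite RintegralZr// Mf0 mul0r subr0.
have cg := condexp_ae_eq mU (is_condexp_section_mean lawUV mg ifp).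
have cE' : is_condexp P U (fun w => (f (V w) - condexp P U (f \o V) w) *
    (p (U w, V w) - condexp P U (fun w => p (U w, V w)) w))
    (section_mean M g2 \o U).
  apply: is_condexp_ae_eqr cE => //.
  - exact: (measurableT_comp mg2 mUV).
  - apply: measurable_funM; apply: measurable_funB.
    + exact: measurableT_comp.
    + exact: measurable_condexp.
    + exact: (measurableT_comp mp mUV).
    + exact: measurable_condexp.
  - by apply: filterS2 Ef Ep => w + + _ => /(_ I) -> /(_ I) ->; rewrite subr0.
have := condexp_ae_eq mU cE'.
apply: filterS3 g2E cg => w g2w + + _ => /(_ I) cgw /(_ I) c2w.
by rewrite /condcov c2w cgw /= g2w.
Qed.


(** * Subsamples as random tuples *)

Lemma subsampleE n (T U : Type) (Z : 'I_n -> T -> U) (J : {set 'I_n}) w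
    (i : 'I_#|J|) : tnth (subsample Z J w) i = Z (enum_val i) w.
Proof. by rewrite (tnth_nth (Z (enum_val i) w)) nth_image. Qed.

(** The order of a subsample is that of its indices in ['I_n], so a subsample
    over a union is only a permutation of the concatenation. *)
Lemma perm_subsampleU n (T : Type) (U : eqType) (Z : 'I_n -> T -> U)
    (J J' : {set 'I_n}) w : (J :&: J' = finset.set0)%SET ->
  perm_eq (subsample Z (J :|: J')%SET w) (subsample Z J w ++ subsample Z J' w).
Proof.
move=> dJ; rewrite /subsample/= /image_mem -map_cat; apply: perm_map.
apply: uniq_perm; first exact: enum_uniq.
  rewrite cat_uniq !enum_uniq/= andbT; apply/hasPn => j.
  rewrite !mem_enum => jJ'; apply/negP => jJ.
  by have := finset.in_set0 j; rewrite -dJ finset.in_setI jJ jJ'.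
by move=> j; rewrite mem_cat !mem_enum finset.in_setU.
Qed.

Lemma measurable_tuple_cat d (T : measurableType d) a b c (abc : (a + b)%N = c) :
  measurable_fun [set: a.-tuple T * b.-tuple T]
    (fun z : a.-tuple T * b.-tuple T => tcast abc [tuple of z.1 ++ z.2]).
Proof.
apply/measurable_fun_tnthP => i; case: c / abc i => i.
rewrite (_ : _ \o _ = fun z : a.-tuple T * b.-tuple T =>
  match fintype.split i with inl j => tnth z.1 j | inr j => tnth z.2 j end).
  case: (fintype.split i) => j.
    exact: (measurableT_comp (measurable_tnth j) measurable_fst).
  exact: (measurableT_comp (measurable_tnth j) measurable_snd).
apply/funext => z /=.
rewrite -{1}(splitK i); case: (fintype.split i) => j /=.
  exact: tnth_lshift.
exact: tnth_rshift.
Qed.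

Lemma measurable_subsample d (T : measurableType d) d' (T' : measurableType d')
    (R : realType) (P : probability T R) n (Z : 'I_n -> {RV P >-> T'})
    (J : {set 'I_n}) :
  measurable_fun setT (subsample (fun j => Z j : T -> T') J).
Proof.
apply/measurable_fun_tnthP => i.
rewrite (_ : _ \o _ = Z (enum_val i)) ?measurable_funP//.
by apply/funext => w /=; rewrite subsampleE.
Qed.

Lemma measurable_tcast d (T : measurableType d) d' (T' : measurableType d')
    a b (ab : a = b) (f : T -> a.-tuple T') :
  measurable_fun setT f -> measurable_fun setT (fun w => tcast ab (f w)).
Proof. by case: b / ab. Qed.

Lemma val_tcast (T : Type) a b (ab : a = b) (t : a.-tuple T) :
  tcast ab t = t :> seq T.
Proof. by case: b / ab. Qed.

(** * Covariance of two fold losses *)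

Theorem lemma5 (R : realType)
  (dX dY dO : measure_display)
  (X : measurableType dX) (Y : measurableType dY) (Omega : measurableType dO)
  (P : probability Omega R) (D : probability (X * Y)%type R)
  (n k : nat) (hn : (0 < n)%N) (hk : (2 <= k)%N) (hkn : (k %| n)%N)
  (Z : 'I_n -> {RV P >-> (X * Y)%type}) (hZ : iid D Z)
  (I : 'I_k -> {set 'I_n}) (hI : is_fold_partition I)
  (A : seq (X * Y) -> X -> Y) (hA : perm_invariant A)
  (loss : Y -> Y -> R)
  (phi psi : seq (X * Y) -> R)
  (hphi : perm_invariant phi) (hpsi : perm_invariant psi)
  (mphi : measurable_fun [set: (n %/ k).-tuple (X * Y)]
            (fun s : (n %/ k).-tuple (X * Y) => phi s))
  (mpsi : measurable_fun [set: (n - n %/ k).-tuple (X * Y)]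
            (fun s : (n - n %/ k).-tuple (X * Y) => psi s))
  (mu : R) :
  let S := subsample (fun j => Z j : Omega -> X * Y) in
  let L (i : 'I_k) (w : Omega) := fold_loss loss A (S (~: I i)%SET w) (S (I i) w) in
  let i1 := fold1 hk in
  let i2 := fold2 hk in
  let S' := S (~: (I i1 :|: I i2))%SET in
  let phi1 (w : Omega) := phi (S (I i1) w) in
  let psi1 (w : Omega) := psi (S' w ++ S (I i1) w) in
  (forall i, P.-integrable [set: Omega] (EFin \o L i)) ->
  P.-integrable [set: Omega] (EFin \o (L i1 \* L i2)) ->
  P.-integrable [set: Omega] (EFin \o (phi1 \* psi1)) ->
  (forall i, 'E_P[L i]%E = mu%:E) ->
  (forall i, {ae P, forall w, L i w = mu + phi (S (I i) w) * psi (S (~: I i)%SET w)}) ->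
  covariance P (L i1) (L i2) =
    'E_P[(fun w => condexp P S' (phi1 \* psi1) w ^+ 2)%R]%E /\
  (P.-integrable [set: Omega] (EFin \o phi1) ->
   P.-integrable [set: Omega] (EFin \o psi1) ->
   'E_P[phi1]%E = 0%:E ->
   covariance P (L i1) (L i2) =
     'E_P[(fun w => condcov P S' phi1 psi1 w ^+ 2)%R]%E).

Proof.
move=> S L i1 i2 S' phi1 psi1 iL iLL ig EL Lform.
have [Idisj _ Icard] := hI.
have I12 : (I i1 :&: I i2)%SET = finset.set0 by exact: Idisj.
set m := (n %/ k)%N in mphi mpsi Icard.
pose J0 := (~: (I i1 :|: I i2))%SET.
(* This is where the shared training sample and one fold together have the size
   of a training sample, on which [psi] is measurable. *)
have cardJ0 : (#|J0| + m)%N = (n - m)%N.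
  have := cardsC (I i1 :|: I i2)%SET.
  rewrite cardsU I12 cards0 subn0 !Icard card_ord => nE.
  rewrite -/J0 in nE; lia.
pose e (s : 'I_#|J0| + ('I_m + 'I_m)) : 'I_n :=
  match s with
  | inl i => enum_val i
  | inr (inl i) => enum_val (cast_ord (esym (Icard i1)) i)
  | inr (inr i) => enum_val (cast_ord (esym (Icard i2)) i)
  end.
have e0 i : (e (inl i) \in I i1 = false) * (e (inl i) \in I i2 = false).
  have : e (inl i) \in J0 by exact: enum_valP.
  by rewrite finset.in_setC finset.in_setU negb_or => /andP[/negbTE-> /negbTE->].
have e1 i : e (inr (inl i)) \in I i1 by exact: enum_valP.
have e2 i : e (inr (inr i)) \in I i2 by exact: enum_valP.
have e12 i j : e (inr (inl i)) <> e (inr (inr j)).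
  move=> eij; have := finset.in_set0 (e (inr (inl i))).
  by rewrite -I12 finset.in_setI e1 eij e2.
have e_inj : injective e.
  case=> [i|[i|i]] [j|[j|j]] eij.
  - by rewrite (enum_val_inj eij).
  - by have := e1 j; rewrite -eij e0.
  - by have := e2 j; rewrite -eij e0.
  - by have := e1 i; rewrite eij e0.
  - by rewrite (cast_ord_inj (enum_val_inj eij)).
  - by case: (e12 i j).
  - by have := e2 i; rewrite eij e0.
  - by case: (e12 j i).
  - by rewrite (cast_ord_inj (enum_val_inj eij)).
have mS J : measurable_fun setT (S J) by exact: measurable_subsample.
pose U : {RV P >-> #|J0|.-tuple (X * Y)} :=
  HB.pack (S J0) (isMeasurableFun.Build _ _ _ _ _ (mS J0)).
(* The sets [I i] have cardinality [m] only propositionally; the casts give both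
   folds the same type of tuples. *)
pose fold i := fun w => tcast (Icard i) (S (I i) w).
have mfold i : measurable_fun setT (fold i) by exact: measurable_tcast.
pose V : {RV P >-> m.-tuple (X * Y)} :=
  HB.pack (fold i1) (isMeasurableFun.Build _ _ _ _ _ (mfold i1)).
pose V' : {RV P >-> m.-tuple (X * Y)} :=
  HB.pack (fold i2) (isMeasurableFun.Build _ _ _ _ _ (mfold i2)).
have law : has_law P (fun w => (U w, (V w, V' w)))
    (prod_prob (distribution P U)
      (prod_prob (distribution P V) (distribution P V))).
  apply: (law_disjoint_subsamples hZ e_inj).
  - by move=> i w; rewrite subsampleE.
  - by move=> i w; rewrite tcastE subsampleE.
  - by move=> i w; rewrite tcastE subsampleE.
pose f (v : m.-tuple (X * Y)) := phi v.
pose p (z : #|J0|.-tuple (X * Y) * m.-tuple (X * Y)) := psi (z.1 ++ z.2).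
have mp : measurable_fun setT p.
  rewrite (_ : p = (fun s : (n - m).-tuple (X * Y) => psi s) \o
      (fun z : #|J0|.-tuple (X * Y) * m.-tuple (X * Y) =>
         tcast cardJ0 [tuple of z.1 ++ z.2])).
    exact: (measurableT_comp mpsi (measurable_tuple_cat cardJ0)).
  by apply/funext => z /=; rewrite /p val_tcast.
pose g z := f z.2 * p z.
have mg : measurable_fun setT g.
  by apply: measurable_funM => //; exact: (measurableT_comp mphi measurable_snd).
have phi1E : phi1 = f \o V.
  by apply/funext => w; rewrite /phi1 /f /= val_tcast.
have psi1E : psi1 = fun w => p (U w, V w).
  by apply/funext => w; rewrite /psi1 /p /= val_tcast.
have gE : phi1 \* psi1 = fun w => g (U w, V w).
  by rewrite phi1E psi1E.
have ig' : P.-integrable setT (fun w => (g (U w, V w))%:E).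
  by move: ig; rewrite gE.
have J0I2 : (~: I i1)%SET = (J0 :|: I i2)%SET.
  apply/setP => j; have := finset.in_set0 j; rewrite -I12 finset.in_setI.
  rewrite finset.in_setU !finset.in_setC finset.in_setU.
  by case: (j \in I i1); case: (j \in I i2).
have J0I1 : (~: I i2)%SET = (J0 :|: I i1)%SET.
  apply/setP => j; have := finset.in_set0 j; rewrite -I12 finset.in_setI.
  rewrite finset.in_setU !finset.in_setC finset.in_setU.
  by case: (j \in I i1); case: (j \in I i2).
have J0d1 : (J0 :&: I i1)%SET = finset.set0.
  apply/setP => j; rewrite finset.in_setI finset.in_set0 finset.in_setC finset.in_setU.
  by case: (j \in I i1); rewrite ?andbF.
have J0d2 : (J0 :&: I i2)%SET = finset.set0.
  apply/setP => j; rewrite finset.in_setI finset.in_set0 finset.in_setC finset.in_setU.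
  by case: (j \in I i2); rewrite ?andbF ?orbT.
have psiE1 w : psi (S (~: I i1)%SET w) = p (U w, V' w).
  by rewrite J0I2 (hpsi _ _ (perm_subsampleU _ w J0d2)) /p /= val_tcast.
have psiE2 w : psi (S (~: I i2)%SET w) = p (U w, V w).
  by rewrite J0I1 (hpsi _ _ (perm_subsampleU _ w J0d1)) /p /= val_tcast.
have mL i : measurable_fun setT (L i).
  by apply/measurable_EFinP; exact: measurable_int (iL i).
pose X12 w := (L i1 w - mu) * (L i2 w - mu).
have mX12 : measurable_fun setT X12.
  by apply: measurable_funM; apply: measurable_funB.
have iX12 : P.-integrable setT (EFin \o X12).
  have imu : P.-integrable setT (EFin \o cst (mu * mu)).
    exact: finite_measure_integrable_cst.
  have := integrableD measurableT
    (integrableB measurableT iLL (integrableZl measurableT mu (iL i1)))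
    (integrableB measurableT imu (integrableZl measurableT mu (iL i2))).
  apply: eq_integrable => // w _; rewrite /X12 /=.
  by congr EFin; ring.
have mgg : measurable_fun setT (fun w => g (U w, V w) * g (U w, V' w)).
  by apply: measurable_funM; apply: (measurableT_comp mg); exact: measurable_fun_pair.
(* Exchanging the two psi factors. *)
have X12E : ae_eq P setT (EFin \o X12) (fun w => (g (U w, V w) * g (U w, V' w))%:E).
  apply: filterS2 (Lform i1) (Lform i2) => w L1 L2 _.
  rewrite /= /X12 L1 L2 psiE1 psiE2 /g /f /= !val_tcast.
  by congr EFin; ring.
have igg : P.-integrable setT (fun w => (g (U w, V w) * g (U w, V' w))%:E).
  by apply: integrable_ae_eq X12E iX12; exact/measurable_EFinP.
have cond := is_condexp_section_mean (has_law_pair law) mg ig'.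
have mU : measurable_fun setT U by exact: mS.
have condE := condexp_ae_eq mU cond.
have mcond : measurable_fun setT (condexp P S' (phi1 \* psi1)).
  exact: measurable_condexp.
have cov : covariance P (L i1) (L i2) =
    'E_P[(fun w => condexp P S' (phi1 \* psi1) w ^+ 2)%R]%E.
  rewrite unlock !EL !unlock.
  transitivity (\int[P]_w (g (U w, V w) * g (U w, V' w))%:E)%E.
    apply: ae_eq_integral => //; exact/measurable_EFinP.
  rewrite (integral_section_mean_sqr law mg)//.
  apply: ae_eq_integral => //.
  - apply/measurable_EFinP; apply: measurable_funX.
    by have [_ iW _] := cond; apply/measurable_EFinP; exact: measurable_int iW.
  - by apply/measurable_EFinP; apply: measurable_funX.
  - by apply: filterS condE => w + _ => /(_ Logic.I); rewrite gE => ->.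
split=> // iphi ipsi Ephi; rewrite cov unlock.
have condcovE : ae_eq P setT (condcov P S' phi1 psi1) (condexp P S' (phi1 \* psi1)).
  rewrite gE; move: Ephi; rewrite unlock => Ephi.
  move: iphi ipsi Ephi; rewrite phi1E psi1E => iphi ipsi Ephi.
  exact: (@condcov_centered _ _ _ _ _ _ _ _ U V f p
    (has_law_pair law) mphi mp iphi ipsi ig' Ephi).
apply: ae_eq_integral => //.
- by apply/measurable_EFinP; apply: measurable_funX.
- by apply/measurable_EFinP; apply: measurable_funX; exact: measurable_condexp.
- by apply: filterS condcovE => w + _ => /(_ Logic.I) ->.
Qed.
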